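(* There is an equation (in the signature $\wedge,\vee,\cdot,\mathrm{e}$ of distributive $\ell$-monoids) that is valid in every finite totally ordered monoid, but not in $\mathbf{Z}=\langle\mathbb{Z},\min,\max,+,0\rangle$.
   Context: A distributive $\ell$-monoid is an algebraic structure $\langle M,\wedge,\vee,\cdot,\mathrm{e}\rangle$ such that $\langle M,\cdot,\mathrm{e}\rangle$ is a monoid, $\langle M,\wedge,\vee\rangle$ is a distributive lattice, and for all $a,b,c,d\in M$, $a(b\vee c)d=abd\vee acd$ and $a(b\wedge c)d=abd\wedge acd$. A totally ordered monoid is a distributive $\ell$-monoid whose lattice order is total. In $\mathbf{Z}$, the operations $\wedge,\vee,\cdot,\mathrm{e}$ are interpreted as $\min,\max,+,0$, respectively. *)

(* Defs.v *)
From HB Require Import structures.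
From mathcomp Require Import all_boot all_order all_algebra.

Set Implicit Arguments.
Unset Strict Implicit.
Unset Printing Implicit Defensive.

Import Order.TTheory GRing.Theory Num.Theory.

(* Associativity of [*] makes the two-sided form a (b \/ c) d = abd \/ acd
   insensitive to bracketing. *)
HB.mixin Record isDistrLMonoid d M
    of Order.DistrLattice d M & monoid.Monoid M := {
  mulg_join2 : forall a b c x : M,
    (a * (Order.join b c) * x = Order.join (a * b * x) (a * c * x))%g;
  mulg_meet2 : forall a b c x : M,
    (a * (Order.meet b c) * x = Order.meet (a * b * x) (a * c * x))%g
}.

#[short(type="distrLMonoidType")]
HB.structure Definition DistrLMonoid d :=
  { M of isDistrLMonoid d M & Order.DistrLattice d M & monoid.Monoid M }.

#[short(type="totalLMonoidType")]
HB.structure Definition TotalLMonoid d :=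
  { M of DistrLMonoid d M & Order.Total d M }.

#[short(type="finTotalLMonoidType")]
HB.structure Definition FinTotalLMonoid d :=
  { M of TotalLMonoid d M & Finite M }.

(* Terms over countably many variables in the signature of distributive
   l-monoids; there is no inverse operation. *)
Inductive lmterm : Type :=
  | LMVar of nat
  | LMOne
  | LMMul of lmterm & lmterm
  | LMMeet of lmterm & lmterm
  | LMJoin of lmterm & lmterm.

Fixpoint lmeval d (M : distrLMonoidType d) (v : nat -> M) (t : lmterm) : M :=
  match t with
  | LMVar i => v i
  | LMOne => 1%g
  | LMMul s u => (lmeval v s * lmeval v u)%g
  | LMMeet s u => Order.meet (lmeval v s) (lmeval v u)
  | LMJoin s u => Order.join (lmeval v s) (lmeval v u)
  end.

(* The pair (s, t) is the equation s = t. *)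
Definition lmequation : Type := (lmterm * lmterm)%type.

Definition lmvalid d (M : distrLMonoidType d) (eq : lmequation) : Prop :=
  forall v : nat -> M, lmeval v eq.1 = lmeval v eq.2.

(* An alias of [int], so that its monoid operation is addition and does not
   interfere with the multiplicative structure of [int]. *)
Definition addint : Type := int.

HB.instance Definition _ := Order.Total.on addint.

HB.instance Definition _ := monoid.isMonoid.Build addint
  (@addrA int) (@add0r int) (@addr0 int).

Lemma addint_join2 (a b c x : addint) :
  (a * (Order.join b c) * x = Order.join (a * b * x) (a * c * x))%g.
Proof.
change ((a : int) + Num.max (b : int) c + x =
  Num.max ((a : int) + b + x) ((a : int) + c + x))%R.
by rewrite addr_maxr addr_maxl.
Qed.

Lemma addint_meet2 (a b c x : addint) :
  (a * (Order.meet b c) * x = Order.meet (a * b * x) (a * c * x))%g.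
Proof.
change ((a : int) + Num.min (b : int) c + x =
  Num.min ((a : int) + b + x) ((a : int) + c + x))%R.
by rewrite addr_minr addr_minl.
Qed.

HB.instance Definition _ := isDistrLMonoid.Build _ addint
  addint_join2 addint_meet2.

Lemma addint_mulE (a b : addint) : (a * b)%g = ((a : int) + (b : int))%R.
Proof. by []. Qed.

Lemma addint_oneE : (1%g : addint) = (0%R : int).
Proof. by []. Qed.

Lemma addint_meetE (a b : addint) :
  Order.meet a b = Num.min (a : int) (b : int).
Proof. by []. Qed.

Lemma addint_joinE (a b : addint) :
  Order.join a b = Num.max (a : int) (b : int).
Proof. by []. Qed.

(* Main.v *)
Require Import Defs.
From HB Require Import structures.
From mathcomp Require Import all_boot all_order all_algebra.

(** The separating equation expresses the inequality a b <= e \/ a^2 b^3.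

    It fails in the integers at a = 3 and b = -2, where a b is 1 while e and
    a^2 b^3 are both 0.

    In a totally ordered monoid the inequality can only fail if a b > e and
    a b > a^2 b^3.  Each of these can be iterated by inserting it between
    powers of a on the left and powers of b on the right, so that no
    commutativity is used: the first gives a b <= a^k b^k for all k > 0
    ([le_nested_expg]), the second gives a^(m+1) b^(2m+1) <= a^2 b^3 < a b for
    all m > 0 ([nested_expg_le]).  If the monoid is finite, some m > 0 makes a^m
    idempotent ([expg_idempotent]), whence a^(2m+1) = a^(m+1).  With k = 2m+1 the
    two bounds then concern the same element and contradict each other.  In the
    integers both iterations are also available, but the powers of a never
    repeat. *)

Import Order.TTheory.

Local Open Scope group_scope.

(** By the pigeonhole principle the powers of a become periodic, say from the
    i-th on with period p.  Any positive multiple m of p with m >= i will then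
    do, since a^(m+m) differs from a^m by a whole number of periods. *)
Lemma expg_idempotent (M : monoidType) (s : seq M) (a : M) :
  (forall n, a ^+ n \in s) -> exists2 m, 0 < m & a ^+ (m + m) = a ^+ m.
Proof.
move=> sP.
have [i [p p_gt0 ip]] : exists i, exists2 p, 0 < p & a ^+ (i + p) = a ^+ i.
  have /(uniqPn 1)[i [j [ltij ltj eqij]]] :
      ~~ uniq [seq a ^+ n | n <- iota 0 (size s).+1].
    apply: contraT => /negbNE /uniq_leq_size -/(_ s).
    rewrite size_map size_iota ltnn; apply=> x /mapP[n _ ->]; exact: sP.
  rewrite size_map size_iota in ltj.
  have lti := ltn_trans ltij ltj.
  exists i, (j - i); first by rewrite subn_gt0.
  move: eqij; rewrite !(nth_map 0) ?size_iota // !nth_iota // !add0n.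
  by rewrite subnKC // ltnW.
have period n t : i <= n -> a ^+ (n + t * p)%N = a ^+ n.
  move=> le_in; elim: t => [|t IHt]; first by rewrite mul0n addn0.
  rewrite mulSn addnA -(subnKC le_in) -!addnA (addnCA _ p) addnA.
  rewrite expgnDr ip -expgnDr addnA subnKC //.
(* The successor keeps the exponent positive when i = 0. *)
exists (i.+1 * p)%N; first by rewrite muln_gt0.
by rewrite period // (leq_trans (leqnSn i)) // leq_pmulr.
Qed.

Section NestedPowers.

Variables (d : Order.disp_t) (M : distrLMonoidType d).
Implicit Types a b c x y : M.

Lemma le_mulg2 a c x y : (x <= y)%O -> (a * x * c <= a * y * c)%O.
Proof. by rewrite !leEjoin -mulg_join2 => /eqP ->. Qed.

(** Inserting a b >= e in the middle of a^k b^k can only increase it. *)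
Lemma le_nested_expg a b k :
  (1 <= a * b)%O -> (a * b <= a ^+ k.+1 * b ^+ k.+1)%O.
Proof.
move=> le1; elim: k => [|k IHk]; first by rewrite !expg1.
apply: (le_trans IHk).
rewrite (expgSr a k.+1) (expgS b k.+1) mulgA -(mulgA _ a b).
by rewrite -{1}(mulg1 (a ^+ k.+1)); apply: le_mulg2.
Qed.

(** Replacing the innermost factor a b of a^(m+1) b^(2m+1) by a^2 b^3 adds one
    to m, and by hypothesis this can only decrease the product. *)
Lemma nested_expg_le a b m :
  (a ^+ 2 * b ^+ 3 <= a * b)%O ->
  (a ^+ m.+2 * b ^+ (m.+1 + m.+1).+1 <= a ^+ 2 * b ^+ 3)%O.
Proof.
move=> le_ab; elim: m => [|m IHm] //.
apply: le_trans IHm.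
have -> : (m.+2 + m.+2).+1 = 3 + (m.+1 + m.+1) by rewrite !addnS !addSn.
rewrite -(addn2 m.+1) (expgnDr a) (expgnDr b) mulgA -(mulgA _ (a ^+ 2)).
rewrite (expgSr a m.+1) (expgS b (m.+1 + m.+1)).
rewrite (mulgA (a ^+ m.+1 * a)) -(mulgA _ a b).
exact: le_mulg2.
Qed.

End NestedPowers.

Lemma finite_mul_le_join (d : Order.disp_t) (M : finTotalLMonoidType d)
    (a b : M) :
  (a * b <= Order.join 1 (a ^+ 2 * b ^+ 3))%O.
Proof.
rewrite lexU; apply: contraT; rewrite negb_or -!ltNge => /andP[lt1 ltab].
have [[|m] // _ am] : exists2 m, 0 < m & a ^+ (m + m) = a ^+ m.
  by apply: (@expg_idempotent M (enum M)) => n; rewrite mem_enum.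
have := @nested_expg_le _ M a b m (ltW ltab).
have := @le_nested_expg _ M a b (m.+1 + m.+1) (ltW lt1).
rewrite expgS am -expgS => /le_trans le_ab /le_ab.
by rewrite leNgt ltab.
Qed.

Local Close Scope group_scope.

Definition LMExp (t : lmterm) (n : nat) : lmterm := iterop n LMMul t LMOne.

Definition LMLe (s t : lmterm) : lmequation := (LMJoin s t, t).

Definition separating_equation : lmequation :=
  let a := LMVar 0 in let b := LMVar 1 in
  LMLe (LMMul a b) (LMJoin LMOne (LMMul (LMExp a 2) (LMExp b 3))).

Theorem proposition5p8 :
  exists eq : lmequation,
    (forall (d : Order.disp_t) (M : finTotalLMonoidType d), lmvalid M eq) /\
    ~ lmvalid addint eq.
Proof.
exists separating_equation; split=> [d M v | /(_ (fun i =>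
  if i is 0 then 3%:Z else - 2%:Z)%R)] //.
by apply/eqP; rewrite /= -leEjoin; apply: finite_mul_le_join.
Qed.
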